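(* Let $p$ be a prime, $m$ a positive integer, $q=p^m$ with $q>2$, and $n=q^2+1$. Let $\lambda\in\mathbb{F}_{q^2}^*$ have multiplicative order $r$, where $r\mid(q+1)$ and $\nu_2(r)=\nu_2(q+1)$. Let $\delta\in\mathbb{F}_{q^4}$ be a primitive $rn$-th root of unity with $\delta^n=\lambda$. Let $g_1(x)=(x-\delta)(x-\delta^{q^2})$ and $g_{q^2+q+1}(x)=(x-\delta^{q^2+q+1})(x-\delta^{q^4+q^3+q^2})$ (the minimal polynomials over $\mathbb{F}_{q^2}$ of $\delta$ and $\delta^{q^2+q+1}$), and let $\mathcal{C}(1,q^2+q+1)$ be the $\lambda$-constacyclic code of length $n$ over $\mathbb{F}_{q^2}$ with check polynomial $g_1(x)g_{q^2+q+1}(x)$. Then $\mathcal{C}(1,q^2+q+1)$ has parameters $[q^2+1,4,q^2-q]$ and weight enumerator \[ 1+(q^5-q)z^{q^2-q}+\frac{(q^4-1)(q-1)q^3}{2}\left(z^{q^2-1}+z^{q^2+1}\right)+(q^7-q^5+q^4-q^3+q-1)z^{q^2}. \] Furthermore, the supports of the minimum weight codewords of $\mathcal{C}(1,q^2+q+1)$ form a $3$-$(q^2+1,q^2-q,(q^2-q-1)(q-2))$ design. The dual code $\mathcal{C}(1,q^2+q+1)^\perp$ has parameters $[q^2+1,q^2-3,4]$, and the supports of its minimum weight codewords form a $3$-$(q^2+1,4,q-2)$ design.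
   Context: $\nu_2$ is the $2$-adic valuation. A $\lambda$-constacyclic code of length $n$ over $\mathbb{F}_{q^2}$ is an ideal of $\mathbb{F}_{q^2}[x]/\langle x^n-\lambda\rangle$ (identifying $(c_0,\dots,c_{n-1})$ with $\sum c_ix^i$); its check polynomial $h(x)$ is $(x^n-\lambda)/g(x)$ where $g$ is the monic generator polynomial. The weight enumerator is $\sum_i A_iz^i$ with $A_i$ the number of codewords of Hamming weight $i$. A $t$-$(v,\kappa,\eta)$ design is a set of $\kappa$-subsets (blocks) of a $v$-set such that every $t$-subset lies in exactly $\eta$ blocks; here the point set is the coordinate set $\{0,\dots,n-1\}$ and the blocks are the distinct supports of codewords of the given weight. *)

(* Defs.v *)
From mathcomp Require Import all_boot all_order all_algebra.
Set Implicit Arguments. Unset Strict Implicit. Unset Printing Implicit Defensive.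
Import GRing.Theory.
Local Open Scope ring_scope.

Definition cw_poly (F : fieldType) (n : nat) (c : 'rV[F]_n) : {poly F} :=
  \sum_(i < n) c 0 i *: 'X^i.

Definition support (F : fieldType) (n : nat) (c : 'rV[F]_n) : {set 'I_n} :=
  [set i | c 0 i != 0].

Definition hweight (F : fieldType) (n : nat) (c : 'rV[F]_n) : nat :=
  #|support c|.

Definition gen_of_check (F : fieldType) (n : nat) (lam : F) (h : {poly F}) :=
  ('X^n - lam%:P) %/ h.

(* lambda-constacyclic code of length n with check polynomial h: the ideal
   generated by g in F[x]/(x^n - lam), i.e. the words whose polynomial
   (of degree < n) is divisible by g. *)
Definition constacyclic_code (F : finFieldType) (n : nat) (lam : F)
    (h : {poly F}) : {set 'rV[F]_n} :=
  [set c | gen_of_check n lam h %| cw_poly c].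

Definition dual_code (F : finFieldType) (n : nat) (C : {set 'rV[F]_n}) :
    {set 'rV[F]_n} :=
  [set d | [forall c in C, c *m d^T == 0]].

Definition code_dim (F : finFieldType) (n : nat) (C : {set 'rV[F]_n}) : nat :=
  \dim <<enum C>>%VS.

Definition min_dist (F : finFieldType) (n : nat) (C : {set 'rV[F]_n}) (d : nat) :=
  (exists2 c, c \in C & (c != 0) && (hweight c == d)) /\
  (forall c, c \in C -> c != 0 -> (d <= hweight c)%N).

Definition code_params (F : finFieldType) (n : nat) (C : {set 'rV[F]_n})
    (k d : nat) := code_dim C = k /\ min_dist C d.

Definition wt_count (F : finFieldType) (n : nat) (C : {set 'rV[F]_n}) (i : nat) :=
  #|[set c in C | hweight c == i]|.

Definition supports_of_weight (F : finFieldType) (n : nat) (C : {set 'rV[F]_n})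
    (w : nat) : {set {set 'I_n}} :=
  [set support c | c in [set c in C | hweight c == w]].

Definition is_design (t v kappa eta : nat) (B : {set {set 'I_v}}) :=
  (forall b, b \in B -> #|b| = kappa) /\
  (forall T : {set 'I_v}, #|T| = t -> #|[set b in B | T \subset b]| = eta).
Arguments is_design t v kappa eta B : clear implicits.

(* Main.v *)
Require Import Defs.
From mathcomp Require Import all_boot all_order all_algebra all_field.
From mathcomp Require Import ring zify.
Set Implicit Arguments. Unset Strict Implicit. Unset Printing Implicit Defensive.
Import GRing.Theory.
Local Open Scope ring_scope.

(** Inverting the discrete Fourier transform on the roots of [x^n - lam] (where
   [n = 1] in [K]) writes every codeword as [c_i = w_i * P (u_i)] with [w_i <> 0],
   [P x = a0 + a1 x + a2 x^q + a3 x^(q+1)] and [u_i] running over the [n]-th roots of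
   unity; the 2-adic condition on [r] makes [delta^(q+1)] of order exactly [n].  If
   [P] has three zeros among the [u_i], a change of coordinates turns [P] into
   [b (y z^q - y^q z)] with [y / z] a cross-ratio, which maps the roots of unity
   bijectively to the projective line over the field of order [q^2]; the zeros are
   the preimage of the projective line over the field of order [q].  So a nonzero
   codeword has 0, 1, 2 or [q + 1] zeros, and the zero sets of size [q + 1] form a
   Steiner system S(3, q + 1, q^2 + 1).  The words vanishing on a set of [j <= 3]
   coordinates number [(q^2)^(4-j)], and the resulting binomial moments determine the
   weight distribution.  Supports of minimum weight words are the complements of the
   blocks, and supports of weight 4 dual words are the 4-subsets of the blocks. *)

(** * Cross-ratios of roots of unity *)

Lemma finField_has_prim_root (K : finFieldType) (d : nat) :
  (0 < d)%N -> (d %| #|K|.-1)%N -> exists z : K, d.-primitive_root z.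
Proof.
move=> d_gt0 dvd_d.
have K_gt1 : (1 < #|K|)%N := finNzRing_gt1 K.
have N_gt0 : (0 < #|K|.-1)%N by case: #|K| K_gt1 => [|[]].
have /hasP[z _ zN] : has (#|K|.-1).-primitive_root (enum (predC1 (0 : K))).
  apply: cyclic.has_prim_root => //; last 2 first.
  - exact: enum_uniq.
  - by rewrite -cardE cardC1.
  apply/allP=> x; rewrite mem_enum inE => x_neq0.
  apply/unity_rootP/(mulfI x_neq0); rewrite mulr1 -exprS prednK ?expf_card //.
  exact: ltnW.
exists (z ^+ (#|K|.-1 %/ d)).
have := exp_prim_root zN (#|K|.-1 %/ d).
by rewrite (gcdn_idPl (dvdn_div dvd_d)) divnA // mulKn.
Qed.

(** The solutions are 0 and the [d.-1] powers of a primitive root of unity. With [d = q] and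
    [d = q ^ 2] this gives the orders of the two subfields that cross-ratios meet. *)
Lemma card_expr_fixed (K : finFieldType) (d : nat) :
  (1 < d)%N -> (d.-1 %| #|K|.-1)%N -> #|[set y : K | y ^+ d == y]| = d.
Proof.
move=> d_gt1 dvd_d.
have d1_gt0 : (0 < d.-1)%N by case: d d_gt1 {dvd_d} => [|[]].
have [z zP] := finField_has_prim_root d1_gt0 dvd_d.
have z_neq0 : z != 0.
  apply/eqP=> z0; have := prim_expr_order zP.
  by rewrite z0 expr0n gtn_eqF // => /esym/eqP; rewrite oner_eq0.
have dE : d = d.-1.+1 by rewrite prednK // ltnW.
have -> : [set y : K | y ^+ d == y] = 0 |: [set z ^+ i | i : 'I_(d.-1)].
  apply/setP=> y; rewrite !inE; have [->|y_neq0] /= := eqVneq y 0.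
    by rewrite dE expr0n eqxx.
  apply/eqP/imsetP => [|[i _ ->]].
    rewrite {1}dE exprS => /(canRL (mulKf y_neq0)); rewrite mulVf // => y1.
    by have [i ->] := prim_rootP zP y1; exists i.
  by rewrite -exprM mulnC {1}dE mulSn exprD exprM (prim_expr_order zP)
             expr1n mulr1.
rewrite cardsU1 card_imset ?card_ord.
  suff -> : (0 : K) \notin [set z ^+ i | i : 'I_(d.-1)] by rewrite add1n.
  by apply/imsetP=> -[i _ /esym/eqP]; rewrite expf_eq0 (negPf z_neq0) andbF.
move=> i j /eqP; rewrite (eq_prim_root_expr zP) !modn_small // => /eqP.
exact: val_inj.
Qed.

(** Polynomials of degree at most 1 in each of [x] and [x ^+ q]; their zero sets play the role of
    plane sections of an elliptic quadric. *)
Definition circle_form (K : fieldType) (q : nat) (a0 a1 a2 a3 x : K) : K :=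
  a0 + a1 * x + a2 * x ^+ q + a3 * (x * x ^+ q).

(* [(x - x1)(x2 - x3)] and [(x - x3)(x2 - x1)] are the numerator and denominator
   of a cross-ratio; a form with the zeros [x1], [x2], [x3] says that the
   cross-ratio is fixed by [y |-> y ^+ q]. *)
Lemma circle_form_three_zeros (K : fieldType) (q : nat) (a0 a1 a2 a3 x1 x2 x3 : K) :
  (forall x y : K, (x - y) ^+ q = x ^+ q - y ^+ q) ->
  x1 != x2 -> x1 != x3 -> x2 != x3 ->
  circle_form q a0 a1 a2 a3 x1 = 0 ->
  circle_form q a0 a1 a2 a3 x2 = 0 ->
  circle_form q a0 a1 a2 a3 x3 = 0 ->
  exists b : K, forall x : K,
    let y := (x - x1) * (x2 - x3) in let z := (x - x3) * (x2 - x1) in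
    circle_form q a0 a1 a2 a3 x = b * (y * z ^+ q - y ^+ q * z).
Proof.
rewrite /circle_form => frob n12 n13 n23 z1 z2 z3.
have e_neq0 : x3 - x1 != 0 by rewrite subr_eq0 eq_sym.
have E_neq0 : x3 ^+ q - x1 ^+ q != 0 by rewrite -frob expf_neq0.
have t_neq0 : x2 - x3 != 0 by rewrite subr_eq0.
have T_neq0 : x2 ^+ q - x3 ^+ q != 0 by rewrite -frob expf_neq0.
have s_neq0 : x2 - x1 != 0 by rewrite subr_eq0 eq_sym.
have S_neq0 : x2 ^+ q - x1 ^+ q != 0 by rewrite -frob expf_neq0.
(* Lagrange interpolation in [x] and [x ^+ q] separately, at the nodes [x1] and [x3]. The two
   diagonal coefficients are the values at [x1] and [x3], which vanish; [b0] and [g0] are the mixed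
   ones. *)
pose b0 := - (a0 + a1 * x3 + a2 * x1 ^+ q + a3 * (x3 * x1 ^+ q)).
pose g0 := - (a0 + a1 * x1 + a2 * x3 ^+ q + a3 * (x1 * x3 ^+ q)).
pose D := (x3 - x1) * (x3 ^+ q - x1 ^+ q).
have D_neq0 : D != 0 by rewrite mulf_neq0.
have expand x : D * (a0 + a1 * x + a2 * x ^+ q + a3 * (x * x ^+ q)) =
    b0 * ((x - x1) * (x ^+ q - x3 ^+ q)) + g0 * ((x ^+ q - x1 ^+ q) * (x - x3)).
  transitivity (
      (a0 + a1 * x1 + a2 * x1 ^+ q + a3 * (x1 * x1 ^+ q)) *
        ((x - x3) * (x ^+ q - x3 ^+ q)) +
      (a0 + a1 * x3 + a2 * x3 ^+ q + a3 * (x3 * x3 ^+ q)) *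
        ((x - x1) * (x ^+ q - x1 ^+ q)) +
      (b0 * ((x - x1) * (x ^+ q - x3 ^+ q)) +
       g0 * ((x ^+ q - x1 ^+ q) * (x - x3)))).
    by rewrite /D /b0 /g0; ring.
  by rewrite z1 z3 !mul0r !add0r.
(* The zero at [x2] fixes the ratio of the two surviving coefficients. *)
have g0E : g0 = - b0 * ((x2 - x1) * (x2 ^+ q - x3 ^+ q))
                / ((x2 ^+ q - x1 ^+ q) * (x2 - x3)).
  apply: (canRL (mulfK (mulf_neq0 S_neq0 t_neq0))).
  have := expand x2; rewrite z2 mulr0 => /esym/eqP; rewrite addrC addr_eq0.
  by move/eqP->; rewrite [RHS]mulNr.
exists (b0 / (D * ((x2 ^+ q - x1 ^+ q) * (x2 - x3)))) => x /=.
apply: (mulfI D_neq0); rewrite expand g0E !exprMn !frob.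
by field; rewrite D_neq0 t_neq0 S_neq0.
Qed.

Section CrossRatio.

Variables (K : finFieldType) (q : nat).
Local Notation n := (q ^ 2 + 1)%N.
Variable u : 'I_n -> K.
Hypotheses (q_gt1 : (1 < q)%N) (cardK : #|K| = (q ^ 4)%N)
  (frob : forall x y : K, (x - y) ^+ q = x ^+ q - y ^+ q)
  (u_inj : injective u) (u_unity : forall i, u i ^+ n = 1).

Lemma unity_neq0 i : u i != 0.
Proof.
apply/eqP=> ui0; have := u_unity i.
by rewrite ui0 addn1 expr0n /= => /esym/eqP; rewrite oner_eq0.
Qed.

(* On the [n]-th roots of unity the map [x |-> x ^+ (q ^ 2)] is inversion,
   which preserves cross-ratios: they lie in the subfield of order [q ^ 2]. *)
Lemma cross_ratio_fixed i1 i2 i3 i : i3 != i2 -> i1 != i2 -> i != i3 ->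
  let c := (u i - u i1) * (u i2 - u i3) / ((u i - u i3) * (u i2 - u i1)) in
  c ^+ (q ^ 2) = c.
Proof.
move=> n32 n12 n3 c.
have frob2 x y : (x - y) ^+ (q ^ 2) = x ^+ (q ^ 2) - y ^+ (q ^ 2) :> K.
  by rewrite -mulnn !exprM !frob.
have uV j : u j ^+ (q ^ 2) = (u j)^-1.
  apply: (mulIf (unity_neq0 j)); rewrite mulVf ?unity_neq0 //.
  by rewrite -exprSr -addn1 u_unity.
rewrite /c expr_div_n !exprMn !frob2 !uV.
have d i4 i5 : i4 != i5 -> u i4 - u i5 != 0 by rewrite subr_eq0 (inj_eq u_inj).
have subV i4 i5 : (u i4)^-1 - (u i5)^-1 = (u i5 - u i4) / (u i4 * u i5).
  by field; rewrite !unity_neq0.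
by rewrite !subV; field; rewrite !unity_neq0 !d // eq_sym.
Qed.

(** The cross-ratio sends [i3] to infinity and the other [q ^ 2] indices injectively, hence
    bijectively, to the subfield of order [q ^ 2]. The equation selects [i3] and the preimages of
    the [q] elements of the smaller subfield. *)
Lemma card_circle i1 i2 i3 : i1 != i2 -> i1 != i3 -> i2 != i3 ->
  #|[set i | (u i - u i1) * (u i2 - u i3) * ((u i - u i3) * (u i2 - u i1)) ^+ q
          == ((u i - u i1) * (u i2 - u i3)) ^+ q * ((u i - u i3) * (u i2 - u i1))]|
  = q.+1.
Proof.
move=> n12 n13 n23; set Z := [set i | _].
pose cr i := (u i - u i1) * (u i2 - u i3) / ((u i - u i3) * (u i2 - u i1)).
have d12 : u i2 - u i1 != 0 by rewrite subr_eq0 (inj_eq u_inj) eq_sym.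
have d13 : u i1 - u i3 != 0 by rewrite subr_eq0 (inj_eq u_inj).
have d23 : u i2 - u i3 != 0 by rewrite subr_eq0 (inj_eq u_inj).
have den_neq0 i : i != i3 -> (u i - u i3) * (u i2 - u i1) != 0.
  by move=> ni; rewrite mulf_neq0 // subr_eq0 (inj_eq u_inj).
have cr_inj : {in [set~ i3] &, injective cr}.
  move=> i j; rewrite !inE => ni nj /eqP.
  rewrite eqr_div ?den_neq0 // -subr_eq0.
  have -> : (u i - u i1) * (u i2 - u i3) * ((u j - u i3) * (u i2 - u i1))
     - (u j - u i1) * (u i2 - u i3) * ((u i - u i3) * (u i2 - u i1)) =
     (u i - u j) * ((u i1 - u i3) * (u i2 - u i3) * (u i2 - u i1)) by ring.
  rewrite mulf_eq0 (negPf (_ : _ * _ * _ != 0)) ?orbF; last by rewrite !mulf_neq0.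
  by rewrite subr_eq0 (inj_eq u_inj) => /eqP.
have dvd_q d : (d %| 4)%N -> ((q ^ d).-1 %| #|K|.-1)%N.
  by case/dvdnP=> e e4; rewrite cardK e4 mulnC expnM dvdn_pred_predX.
have cr_onto : cr @: [set~ i3] = [set y | y ^+ (q ^ 2) == y].
  apply/eqP; rewrite eqEcard; apply/andP; split.
    apply/subsetP=> _ /imsetP[i ni ->]; rewrite !inE in ni *.
    by apply/eqP/cross_ratio_fixed => //; rewrite eq_sym.
  rewrite card_in_imset // cardsC1 card_ord addn1.
  by rewrite card_expr_fixed ?dvd_q // -mulnn; nia.
have ZE : Z = i3 |: [set i in [set~ i3] | cr i \in [set y | y ^+ q == y]].
  apply/setP=> i; rewrite !inE.
  have [->|ni] /= := eqVneq i i3.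
    by rewrite subrr mul0r expr0n gtn_eqF ?(ltnW q_gt1) // !mulr0 eqxx.
  rewrite /cr expr_div_n [RHS]eq_sym eqr_div ?expf_neq0 ?den_neq0 //.
rewrite ZE cardsU1 !inE eqxx add1n; congr _.+1.
rewrite -(card_in_imset (f := cr)); last first.
  by move=> i j; rewrite !inE => /andP[ni _] /andP[nj _]; apply: cr_inj; rewrite !inE.
transitivity #|[set y : K | y ^+ q == y]|; last first.
  by rewrite card_expr_fixed // -(expn1 q) dvd_q.
apply: eq_card => y; apply/imsetP/idP => [[i + ->]|yq].
  by rewrite inE => /andP[_].
have : y \in [set y | y ^+ (q ^ 2) == y].
  by move: yq; rewrite !inE => /eqP yq; rewrite -mulnn exprM !yq.
rewrite -cr_onto => /imsetP[i ni yE]; exists i => //.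
by rewrite inE ni -yE.
Qed.

End CrossRatio.

(** The function [psi] depends on [S] alone. This uniformity yields both consequences used later: a
    nonzero form vanishing on [S] has [q.+1] zeros, and two such forms are proportional. *)
Lemma circle_pencil (K : finFieldType) (q n : nat) (u : 'I_n -> K) (S : {set 'I_n}) :
  n = (q ^ 2 + 1)%N -> (1 < q)%N -> #|K| = (q ^ 4)%N ->
  (forall x y : K, (x - y) ^+ q = x ^+ q - y ^+ q) ->
  injective u -> (forall i, u i ^+ n = 1) -> #|S| = 3 ->
  exists2 psi : 'I_n -> K, #|[set i | psi i == 0]| = q.+1 &
    forall a0 a1 a2 a3, (forall i, i \in S -> circle_form q a0 a1 a2 a3 (u i) = 0) ->
    exists b, forall i, circle_form q a0 a1 a2 a3 (u i) = b * psi i.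
Proof.
move=> nE q_gt1 cardK frob u_inj u_unity S3; subst n.
have /card_gt2P[i1 [i2 [i3 [[S1 S2 S3'] [n12 n23 n31]]]]] : (2 < #|S|)%N by rewrite S3.
rewrite eq_sym in n31.
pose y i := (u i - u i1) * (u i2 - u i3); pose z i := (u i - u i3) * (u i2 - u i1).
exists (fun i => y i * z i ^+ q - y i ^+ q * z i).
  rewrite -(card_circle q_gt1 cardK frob u_inj u_unity n12 n31 n23).
  by apply: eq_card => i; rewrite !inE subr_eq0.
move=> a0 a1 a2 a3 zS.
have [|||b bE] := circle_form_three_zeros frob _ _ _ (zS _ S1) (zS _ S2) (zS _ S3');
  rewrite ?(inj_eq u_inj) //; last by exists b => i; apply: bE.
Qed.

(** * Steiner systems and their complements *)

Section Blocks.

Variables (T : finType) (B : {set {set T}}).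

Definition blocks_through (A : {set T}) : {set {set T}} :=
  [set b in B | A \subset b].

Definition blocks_through_avoiding (A D : {set T}) : {set {set T}} :=
  [set b in blocks_through A | [disjoint D & b]].

(** Double counting of the pairs of a point [x] outside [A] and a block containing [x |: A]. *)
Lemma sum_blocks_through (k : nat) (A : {set T}) :
  (forall b, b \in B -> #|b| = k) ->
  (\sum_(x in ~: A) #|blocks_through (x |: A)| = #|blocks_through A| * (k - #|A|))%N.
Proof.
move=> sizeB; rewrite -sum_nat_const.
under eq_bigr do rewrite -sum1dep_card.
rewrite (exchange_big_dep (mem (blocks_through A))) /=.
  apply: eq_bigr => b; rewrite inE => /andP[bB Ab].
  rewrite sum1dep_card -(sizeB b bB) -cardsDS //; apply: eq_card => x.
  by rewrite !inE bB /= subUset sub1set Ab andbT.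
by move=> x b _; rewrite !inE subUset => /and3P[-> _ ->].
Qed.

(** The descent from sets of size [#|A| + 1] to [A]. The relation between [l] and [l'] is
    cross-multiplied to avoid division; [#|A| < k] allows the cancellation. *)
Lemma card_blocks_throughS (k v l l' : nat) (A : {set T}) :
  (forall b, b \in B -> #|b| = k) -> #|T| = v ->
  (forall x, x \notin A -> #|blocks_through (x |: A)| = l) ->
  ((v - #|A|) * l = l' * (k - #|A|))%N -> (#|A| < k)%N ->
  #|blocks_through A| = l'.
Proof.
move=> sizeB cardT lP le ltAk; have := sum_blocks_through A sizeB.
rewrite (eq_bigr (fun=> l)) => [|x]; last by rewrite inE; exact: lP.
rewrite sum_nat_const cardsCs setCK cardT le => /eqP.
by rewrite eqn_pmul2r ?subn_gt0 // => /eqP.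
Qed.

(** Inclusion-exclusion as a recursion (the intersection triangle of a design): blocks through [a]
    points that avoid [d'] others, minus those that also pass through one more point. *)
Fixpoint avoiding_number (f : nat -> nat) (a d : nat) : nat :=
  if d is d'.+1 then avoiding_number f a d' - avoiding_number f a.+1 d' else f a.

(** Induction on [D]: the blocks avoiding [D] are those avoiding [D :\ x], without those that
    contain [x]. The sets are nested, so the truncated subtraction is exact. *)
Lemma card_blocks_through_avoiding (f : nat -> nat) (t : nat) (A D : {set T}) :
  (forall S : {set T}, (#|S| <= t)%N -> #|blocks_through S| = f #|S|) ->
  [disjoint A & D] -> (#|A| + #|D| <= t)%N ->
  #|blocks_through_avoiding A D| = avoiding_number f #|A| #|D|.
Proof.
move=> lambda; move Dd: #|D| => d; elim: d A D Dd => [|d IHd] A D Dd disjAD le_t.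
  have -> : D = set0 by apply: cards0_eq.
  rewrite /= -lambda; last by rewrite -[#|A|]addn0.
  by apply: eq_card => b; rewrite inE disjoints_subset sub0set andbT.
have /card_gt0P[x xD] : (0 < #|D|)%N by rewrite Dd.
have xA : x \notin A by move: disjAD; rewrite disjoint_sym => /disjointFr->.
have cardD : #|D :\ x| = d by apply: succn_inj; rewrite -Dd (cardsD1 x D) xD.
have disj' : [disjoint A & D :\ x] by apply: disjointWr disjAD; apply: subsetDl.
have disjx : [disjoint x |: A & D :\ x].
  by rewrite disjoints_subset subUset sub1set !inE eqxx -disjoints_subset.
have -> : blocks_through_avoiding A D =
    blocks_through_avoiding A (D :\ x) :\: blocks_through_avoiding (x |: A) (D :\ x).
  apply/setP=> b; rewrite !inE -{1}(setD1K xD) !disjoints_subset !subUset !sub1set inE.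
  by case: (b \in B); case: (x \in b); case: (A \subset b); case: (_ :\ _ \subset _).
rewrite cardsDS; last first.
  by apply/subsetP=> b; rewrite !inE subUset => /andP[/and3P[-> _ ->] ->].
rewrite (IHd _ _ cardD disj'); last by apply: leq_trans le_t; rewrite leq_add2l.
by rewrite (IHd _ _ cardD disjx) cardsU1 xA add1n ?addSn -?addnS.
Qed.

End Blocks.

Section InversivePlane.

Variables (T : finType) (q : nat) (B : {set {set T}}).
Hypotheses (q_gt1 : (1 < q)%N) (cardT : #|T| = (q ^ 2 + 1)%N)
  (sizeB : forall b, b \in B -> #|b| = q.+1)
  (steiner : forall S : {set T}, #|S| = 3 -> #|blocks_through B S| = 1%N).

(* The default value of [nth] is the entry at [j = 3]. *)
Definition inversive_lambda (j : nat) : nat :=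
  nth 1%N [:: q * (q ^ 2 + 1); q * (q + 1); q + 1]%N j.

Lemma card_blocks_through_inversive (S : {set T}) :
  (#|S| <= 3)%N -> #|blocks_through B S| = inversive_lambda #|S|.
Proof.
have step j l : (j < 3)%N -> ((q ^ 2 + 1 - j) * l = inversive_lambda j * (q.+1 - j))%N ->
    (forall S0 : {set T}, #|S0| = j.+1 -> #|blocks_through B S0| = l) ->
    forall S0 : {set T}, #|S0| = j -> #|blocks_through B S0| = inversive_lambda j.
  move=> j3 le lP S0 cS; rewrite -cS in le j3 *.
  apply: (card_blocks_throughS sizeB cardT (l := l)).
  - by move=> x xS; apply: lP; rewrite cardsU1 xS add1n cS.
  - exact: le.
  - lia.
have l2 (S0 : {set T}) : #|S0| = 2 -> #|blocks_through B S0| = inversive_lambda 2.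
  by apply: (step 2 1%N) => //; rewrite /inversive_lambda /= -mulnn; nia.
have l1 (S0 : {set T}) : #|S0| = 1%N -> #|blocks_through B S0| = inversive_lambda 1.
  by apply: (step 1 _ isT _ l2); rewrite /inversive_lambda /= -mulnn; nia.
have l0 (S0 : {set T}) : #|S0| = 0 -> #|blocks_through B S0| = inversive_lambda 0.
  by apply: (step 0 _ isT _ l1); rewrite /inversive_lambda /= -mulnn; nia.
case E: #|S| => [|[|[|[|//]]]] _; [exact: l0|exact: l1|exact: l2|].
exact: steiner.
Qed.

(** Complements of these blocks are the blocks of the complementary design that contain [S]. The
    number is the alternating sum of [inversive_lambda j] with coefficients 1, -3, 3, -1. *)
Lemma card_blocks_avoiding_inversive (S : {set T}) : #|S| = 3 ->
  #|[set b in B | [disjoint S & b]]| = ((q ^ 2 - q - 1) * (q - 2))%N.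
Proof.
move=> S3.
have := card_blocks_through_avoiding card_blocks_through_inversive
  (_ : [disjoint set0 & S]) (_ : #|set0 : {set T}| + #|S| <= 3)%N.
rewrite disjoints_subset sub0set cards0 S3 => /(_ isT isT) /=.
have -> : [set b in B | [disjoint S & b]] = blocks_through_avoiding B set0 S.
  by apply/setP=> b; rewrite !inE sub0set andbT.
move->; rewrite /inversive_lambda /= -mulnn; case: q q_gt1 => [//|[//|k] _].
nia.
Qed.

End InversivePlane.

(** * Words vanishing on a set of coordinates *)

Lemma code_dim_vspace (F : finFieldType) (n : nat) (C : {set 'rV[F]_n})
    (V : {vspace 'rV[F]_n}) : C =i V -> code_dim C = \dim V.
Proof.
move=> CV; congr (\dim _); apply/eqP; rewrite eqEsubv; apply/andP; split.
  by apply/span_subvP=> c; rewrite mem_enum CV.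
by apply/subvP=> c; rewrite -CV => cC; apply: memv_span; rewrite mem_enum.
Qed.

Definition zeros (F : fieldType) (n : nat) (c : 'rV[F]_n) : {set 'I_n} :=
  ~: Defs.support c.

Lemma in_zeros (F : fieldType) (n : nat) (c : 'rV[F]_n) i :
  (i \in zeros c) = (c 0 i == 0).
Proof. by rewrite !inE negbK. Qed.

Lemma zerosB (F : fieldType) (n : nat) (S : {set 'I_n}) (c d : 'rV[F]_n) :
  S \subset zeros c -> S \subset zeros d -> S \subset zeros (c - d).
Proof.
move=> /subsetP Sc /subsetP Sd; apply/subsetP=> i iS.
have := Sc i iS; have := Sd i iS; rewrite !in_zeros !mxE => /eqP-> /eqP->.
by rewrite subr0.
Qed.

Lemma zerosZ (F : fieldType) (n : nat) (a : F) (c : 'rV[F]_n) :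
  a != 0 -> zeros (a *: c) = zeros c.
Proof. by move=> a0; apply/setP=> i; rewrite !in_zeros mxE mulf_eq0 (negPf a0). Qed.

Lemma hweight_zeros (F : fieldType) (n : nat) (c : 'rV[F]_n) :
  (hweight c + #|zeros c|)%N = n.
Proof. by rewrite cardsC card_ord. Qed.

Lemma zeros0 (F : fieldType) (n : nat) : zeros (0 : 'rV[F]_n) = setT.
Proof. by apply/setP=> i; rewrite in_zeros mxE eqxx inE. Qed.

Lemma hweight_eq0 (F : fieldType) (n : nat) (c : 'rV[F]_n) :
  (hweight c == 0%N) = (c == 0).
Proof.
rewrite cards_eq0; apply/eqP/eqP=> [s0|->].
  apply/rowP=> i; rewrite mxE; apply/eqP; apply: contraFT (in_set0 i).
  by rewrite -s0 inE.
by apply/setP=> i; rewrite !inE mxE eqxx.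
Qed.

Lemma subset_of_card (T : finType) (j : nat) (S : {set T}) :
  (#|S| <= j <= #|T|)%N -> exists2 S' : {set T}, S \subset S' & #|S'| = j.
Proof.
case/andP=> le1 le2.
have : (0 < #|[set D : {set T} | D \subset ~: S & #|D| == j - #|S|]|)%N.
  by rewrite cards_draws bin_gt0 [#|~: S|]cardsCs setCK leq_sub2r.
case/card_gt0P=> D; rewrite inE => /andP[DS /eqP cD].
exists (S :|: D); first exact: subsetUl.
rewrite cardsU cD disjoint_setI0 ?cards0 ?subn0 ?subnKC //.
by rewrite disjoint_sym disjoints_subset.
Qed.

Section Vanishing.

Variables (F : finFieldType) (n : nat) (C : {set 'rV[F]_n}).
Hypothesis CB : forall c d, c \in C -> d \in C -> c - d \in C.

Definition vanishing (S : {set 'I_n}) : {set 'rV[F]_n} :=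
  [set c in C | S \subset zeros c].

Lemma vanishingB S c d :
  c \in vanishing S -> d \in vanishing S -> c - d \in vanishing S.
Proof.
rewrite !inE => /andP[cC cS] /andP[dC dS].
by rewrite CB //= zerosB.
Qed.

Lemma vanishing0 : vanishing set0 = C.
Proof. by apply/setP=> c; rewrite inE sub0set andbT. Qed.

(** Partition by the value at [x]: subtracting a fixed member of a nonempty fibre maps that fibre
    injectively into [vanishing (x |: S)]. *)
Lemma card_vanishing_setU1 (x : 'I_n) S :
  (#|vanishing S| <= #|F| * #|vanishing (x |: S)|)%N.
Proof.
rewrite -sum1_card (partition_big (fun c : 'rV[F]_n => c 0 x) predT) //=.
rewrite -sum_nat_const; apply: leq_sum => a _; rewrite sum1dep_card.
have [->|[c0]] := set_0Vmem [set c in vanishing S | c 0 x == a].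
  by rewrite cards0.
rewrite inE => /andP[c0S /eqP c0x].
rewrite -(card_imset _ (addIr (- c0))); apply: subset_leq_card.
apply/subsetP=> _ /imsetP[c + ->]; rewrite inE => /andP[cS /eqP cx].
have := vanishingB cS c0S; rewrite !inE => /andP[-> cc0].
by rewrite subUset cc0 sub1set in_zeros !mxE cx c0x subrr eqxx.
Qed.

Lemma card_vanishing_sub (S S' : {set 'I_n}) : S \subset S' ->
  (#|vanishing S| <= #|F| ^ (#|S'| - #|S|) * #|vanishing S'|)%N.
Proof.
move: {2}(#|S'| - #|S|)%N (erefl (#|S'| - #|S|)%N) => k.
elim: k S => [|k IHk] S dk sSS'.
  suff -> : S' = S by rewrite subnn mul1n.
  by apply/eqP; rewrite eq_sym eqEcard sSS' -subn_eq0 dk.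
have /subsetPn[x xS' xS] : ~~ (S' \subset S).
  by apply: contraTN isT => /subset_leq_card; rewrite -subn_eq0 dk.
have dk' : (#|S'| - #|x |: S|)%N = k by rewrite cardsU1 xS add1n subnS dk.
have := IHk (x |: S) dk'; rewrite subUset sub1set xS' dk' dk => /(_ sSS') le_k.
apply: leq_trans (card_vanishing_setU1 x S) _.
by rewrite expnS -mulnA leq_mul2l le_k orbT.
Qed.

(** Double counting of the pairs of a codeword and a [j]-set inside its zero set: the [j]-th
    binomial moment of the number of zeros. *)
Lemma sum_bin_zeros j l : (forall S : {set 'I_n}, #|S| = j -> #|vanishing S| = l) ->
  (\sum_(c in C) 'C(#|zeros c|, j) = 'C(n, j) * l)%N.
Proof.
move=> vS.
under eq_bigr do rewrite -cards_draws -sum1dep_card.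
rewrite (exchange_big_dep (fun S : {set 'I_n} => #|S| == j)) /=; last first.
  by move=> c S _ /andP[].
have -> : 'C(n, j) = #|[set S : {set 'I_n} | #|S| == j]| by rewrite card_draws card_ord.
rewrite -sum_nat_const [RHS](eq_bigl (fun S : {set 'I_n} => #|S| == j));
  last by move=> S; rewrite inE.
apply: eq_bigr => S /eqP cS; rewrite -(vS S cS) sum1dep_card.
by apply: eq_card => c; rewrite !inE cS eqxx andbT.
Qed.

End Vanishing.

(** * Codes whose long zero sets form an inversive plane *)

Lemma subn_eq (x y z : nat) : x = (z + y)%N -> (x - y = z)%N.
Proof. by move->; rewrite addnK. Qed.

(** With [q = b.+1], this and the next two identities turn the truncated differences of the weight
    enumerator into polynomials in [b] without subtraction. *)
Lemma succ_exp4_sub (b : nat) :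
  (b.+1 ^ 4 - 1 = b * (b + 2) * (b.+1 ^ 2 + 1))%N.
Proof. by apply: subn_eq; rewrite -[b.+1]addn1; ring. Qed.

Lemma succ_exp5_sub (b : nat) :
  (b.+1 ^ 5 - b.+1 = b * (b + 2) * (b.+1 ^ 2 + 1) * b.+1)%N.
Proof. by apply: subn_eq; rewrite -[b.+1]addn1; ring. Qed.

Lemma succ_exp7_sub (b : nat) :
  (b.+1 ^ 7 - b.+1 ^ 5 + b.+1 ^ 4 - b.+1 ^ 3 + b.+1 - 1
   = b.+1 ^ 5 * (b * (b + 2)) + b.+1 ^ 3 * b + b)%N.
Proof.
rewrite (@subn_eq (b.+1 ^ 7) _ (b.+1 ^ 5 * (b * (b + 2)))); last first.
  by rewrite -[b.+1]addn1; ring.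
rewrite (@subn_eq _ (b.+1 ^ 3) (b.+1 ^ 5 * (b * (b + 2)) + b.+1 ^ 3 * b)); last first.
  by rewrite -[b.+1]addn1; ring.
by apply: subn_eq; rewrite -[b.+1]addn1; ring.
Qed.

Section FourDimensionalCode.

Variables (F : finFieldType) (q n : nat) (G : 'M[F]_(4, n)) (C : {set 'rV[F]_n}).
Hypotheses (q_gt2 : (2 < q)%N) (nE : n = (q ^ 2 + 1)%N) (cardF : #|F| = (q ^ 2)%N).
Hypotheses (freeG : row_free G) (CE : C = [set x *m G | x : 'rV[F]_4]).
(** These two hypotheses are all that the combinatorial part takes from the cross-ratio argument. *)
Hypothesis three_zeros : forall c, c \in C -> c != 0 ->
  (3 <= #|zeros c|)%N -> #|zeros c| = q.+1.
Hypothesis three_zeros_proportional : forall (S : {set 'I_n}) c d i, #|S| = 3 ->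
  c \in vanishing C S -> d \in vanishing C S -> c 0 i != 0 -> d 0 i = 0 -> d = 0.

Lemma length_gt : (q.+1 < n)%N.
Proof. by rewrite nE -mulnn; nia. Qed.

Lemma row_code0 : 0 \in C.
Proof. by rewrite CE; apply/imsetP; exists 0; rewrite ?mul0mx. Qed.

Lemma row_codeB c d : c \in C -> d \in C -> c - d \in C.
Proof.
rewrite CE => /imsetP[x _ ->] /imsetP[y _ ->].
by apply/imsetP; exists (x - y); rewrite ?mulmxBl.
Qed.

Lemma row_codeZ a c : c \in C -> a *: c \in C.
Proof.
rewrite CE => /imsetP[x _ ->].
by apply/imsetP; exists (a *: x); rewrite ?scalemxAl.
Qed.

Lemma card_row_code : #|C| = (#|F| ^ 4)%N.
Proof.
rewrite CE card_imset; first by rewrite card_mx mul1n.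
exact: row_free_inj freeG.
Qed.

(** If a nonzero [c] vanishes on [S], evaluation at a coordinate where [c] does not vanish is
    injective on [vanishing C S], by proportionality. *)
Lemma vanishing_leq (S : {set 'I_n}) : #|S| = 3 -> (#|vanishing C S| <= #|F|)%N.
Proof.
move=> S3; have [V0|[c]] := set_0Vmem (vanishing C S :\ 0).
  rewrite (cardsD1 0) V0 cards0 addn0; apply: leq_trans (leq_b1 _) _.
  exact: ltnW (finNzRing_gt1 F).
rewrite !inE => /andP[c0 cV].
have /set0Pn[i]: Defs.support c != set0.
  by apply: contraNneq c0 => s0; rewrite -hweight_eq0 /hweight s0 cards0.
rewrite inE => ci0.
rewrite -(card_in_imset (f := fun d : 'rV[F]_n => d 0 i)) ?max_card //.
move=> d e dV eV dei; apply/eqP; rewrite -subr_eq0; apply/eqP.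
apply: (three_zeros_proportional S3 _ (vanishingB row_codeB dV eV) ci0).
  by rewrite inE.
by rewrite !mxE dei subrr.
Qed.

(** Each added coordinate divides the count by at most [#|F|]. Growing [S] to a 3-set gives the
    upper bound; starting from the whole code gives the lower one. *)
Lemma card_vanishing (S : {set 'I_n}) : (#|S| <= 3)%N ->
  #|vanishing C S| = (#|F| ^ (4 - #|S|))%N.
Proof.
move=> S_le3; have F_gt0 : (0 < #|F|)%N by apply: ltnW (finNzRing_gt1 F).
apply/eqP; rewrite eqn_leq; apply/andP; split.
  have [|S' sSS' S'3] := @subset_of_card _ 3 S.
    by rewrite S_le3 card_ord; have := length_gt; lia.
  apply: leq_trans (card_vanishing_sub row_codeB sSS') _.
  by rewrite S'3 (subSn S_le3) expnSr leq_mul2l vanishing_leq // orbT.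
have := card_vanishing_sub row_codeB (sub0set S).
rewrite vanishing0 card_row_code cards0 subn0 -{1}(subnK (leqW S_le3)) addnC expnD.
by rewrite leq_pmul2l // expn_gt0 F_gt0.
Qed.

(** The [#|F|] distinct multiples of [c] already exhaust [vanishing C S]. *)
Lemma vanishing_line (S : {set 'I_n}) c d : #|S| = 3 -> c \in vanishing C S -> c != 0 ->
  d \in vanishing C S -> exists a, d = a *: c.
Proof.
move=> S3 cV c0 dV.
have sub : [set a *: c | a : F] \subset vanishing C S.
  apply/subsetP=> _ /imsetP[a _ ->]; move: cV; rewrite !inE => /andP[cC Sc].
  rewrite row_codeZ //=; have [->|a0] := eqVneq a 0; last by rewrite zerosZ.
  by rewrite scale0r zeros0 subsetT.
have inj : injective (fun a : F => a *: c).
  move=> a b /eqP; rewrite -subr_eq0 -scalerBl scaler_eq0 (negPf c0) orbF subr_eq0.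
  by move/eqP.
have /eqP E : [set a *: c | a : F] == vanishing C S.
  by rewrite eqEcard sub card_imset // vanishing_leq.
by move: dV; rewrite -E => /imsetP[a _ ->]; exists a.
Qed.

(** * The inversive plane formed by the zero sets of size [q.+1] *)

Definition circles : {set {set 'I_n}} :=
  [set zeros c | c in [set c in C | #|zeros c| == q.+1]].

Lemma circlesP b : reflect
  (exists2 c, c \in C /\ c != 0 & b = zeros c /\ #|b| = q.+1) (b \in circles).
Proof.
apply: (iffP imsetP) => [[c + ->]|[c [cC c0] [-> zc]]].
  rewrite inE => /andP[cC /eqP zc]; exists c => //; split=> //.
  apply: contra_eqN zc => /eqP ->; rewrite zeros0 cardsT card_ord.
  by rewrite gtn_eqF // length_gt.
by exists c; rewrite // inE cC zc eqxx.
Qed.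

Lemma card_circles b : b \in circles -> #|b| = q.+1.
Proof. by case/circlesP=> c _ []. Qed.

Lemma ex_vanishing (S : {set 'I_n}) : #|S| = 3 -> exists2 c, c \in vanishing C S & c != 0.
Proof.
move=> S3.
have : (1 < #|vanishing C S|)%N by rewrite card_vanishing S3 ?expn1 ?finNzRing_gt1.
rewrite (cardsD1 0) => V1; have : (0 < #|vanishing C S :\ 0%R|)%N.
  by move: V1; case: (_ \in _); rewrite ?add1n // add0n => /ltnW.
by case/card_gt0P=> c; rewrite !in_setD1 => /andP[c0 cV]; exists c.
Qed.

Lemma vanishing_circle (S : {set 'I_n}) c : #|S| = 3 -> c \in vanishing C S -> c != 0 ->
  zeros c \in circles.
Proof.
move=> S3; rewrite inE => /andP[cC Sc] c0; apply/circlesP; exists c => //; split=> //.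
by apply: three_zeros => //; have := subset_leq_card Sc; rewrite S3.
Qed.

(** A nonzero word vanishing on [S] exists by counting and has a circle as its zero set; it is
    unique up to a scalar, so the circle is unique. *)
Lemma circles_steiner (S : {set 'I_n}) : #|S| = 3 -> #|blocks_through circles S| = 1%N.
Proof.
move=> S3; have [c cV c0] := ex_vanishing S3.
apply/eqP/cards1P; exists (zeros c); apply/setP=> b; rewrite !inE.
apply/andP/eqP=> [[/circlesP[d [dC d0] [-> _]] Sd]|->].
  have dV : d \in vanishing C S by rewrite inE dC.
  have [a dE] := vanishing_line S3 cV c0 dV.
  by rewrite dE zerosZ //; apply: contraNneq d0 => a0; rewrite dE a0 scale0r.
split; first exact: (vanishing_circle S3).
by move: cV; rewrite inE => /andP[].
Qed.

Lemma zeros_cases c : c \in C -> c != 0 -> #|zeros c| \in [:: 0; 1; 2; q.+1]%N.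
Proof.
move=> cC c0; rewrite !inE; have := three_zeros cC c0.
by case: #|zeros c| => [|[|[|z]]] // /(_ isT)->; rewrite eqxx !orbT.
Qed.

(** * Weight distribution from the binomial moments *)

Definition zeros_count (j : nat) : nat := #|[set c in C | #|zeros c| == j]|.

(** The term [f n] is the contribution of the zero word; all other words fall under
    [zeros_cases]. *)
Lemma sum_zeros (f : nat -> nat) : (\sum_(c in C) f #|zeros c| = f n +
  (zeros_count 0 * f 0 + zeros_count 1 * f 1 + zeros_count 2 * f 2 +
   zeros_count q.+1 * f q.+1))%N.
Proof.
rewrite (bigD1 0 row_code0) /= zeros0 cardsT card_ord; congr addn.
have cnt j : (j < n)%N ->
 (\sum_(c in C | c != 0%R) (#|zeros c| == j) = zeros_count j)%N.
  move=> jn; rewrite -big_mkcondr /= sum1dep_card; apply: eq_card => c; rewrite !inE.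
  case: eqVneq => [->|_]; last by rewrite andbT.
  by rewrite zeros0 cardsT card_ord gtn_eqF // !andbF.
have lt_n j : (j <= q.+1)%N -> (j < n)%N by move/leq_ltn_trans; apply; exact: length_gt.
rewrite -!cnt ?lt_n //; try lia.
rewrite !big_distrl -!big_split /=; apply: eq_bigr => c /andP[cC c0].
have q0 : (q == 0%N) = false by lia.
have q1 : (q == 1%N) = false by lia.
have := zeros_cases cC c0; rewrite !inE => /or4P[] /eqP-> /=;
  rewrite ?eqSS ?[_ == q]eq_sym ?eqxx ?q0 ?q1 ?mul1n ?mul0n ?addn0 ?add0n //.
Qed.

(** A triangular system for the four unknown counts, since ['C(i, j)] vanishes for [i < j]; it is
    solved from [j = 3] down to [j = 0]. *)
Lemma sum_bin_zeros_count j : (j <= 3)%N -> ('C(n, j) +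
   (zeros_count 0 * 'C(0, j) + zeros_count 1 * 'C(1, j) + zeros_count 2 * 'C(2, j) +
    zeros_count q.+1 * 'C(q.+1, j)) = 'C(n, j) * (q ^ 2) ^ (4 - j))%N.
Proof.
move=> j_le3; rewrite -(sum_zeros (fun z => 'C(z, j))) -cardF.
by apply: (sum_bin_zeros (C := C)) => S Sj; rewrite card_vanishing Sj.
Qed.

Lemma zeros_count_circle : zeros_count q.+1 = (q ^ 5 - q)%N.
Proof.
have := sum_bin_zeros_count (leqnn 3).
rewrite (@bin_small 0) // (@bin_small 1) // (@bin_small 2) // !muln0 !add0n expn1.
(* Multiplying by [3!] replaces binomials by falling factorials, which are polynomial in [q]. *)
move/(congr1 (muln^~ 3`!)); rewrite /= mulnDl -mulnA mulnAC !bin_ffact.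
rewrite nE addn1 !ffactnS !ffactn0 !muln1 /=.
move: (zeros_count _) => N; case: q q_gt2 => [//|[//|k]] _.
by move=> E; nia.
Qed.

(** Doubling keeps the equations free of division and shows that the later quotient by 2 is
    exact. *)
Lemma double_zeros_count_secant :
  (zeros_count 2 * 2 = (q ^ 4 - 1) * (q - 1) * q ^ 3)%N.
Proof.
have := sum_bin_zeros_count (leqnSn 2).
rewrite (@bin_small 0) // (@bin_small 1) // binn !muln0 !add0n muln1.
move/(congr1 (muln^~ 2`!)); rewrite /= !mulnDl -(mulnA _ 'C(q.+1, 2)) mulnAC !bin_ffact.
rewrite nE addn1 !ffactnS !ffactn0 !muln1 zeros_count_circle /= (_ : 2`! = 2%N) //.
move: (zeros_count _) => N; case: q q_gt2 => [//|b] _.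
rewrite succ_exp5_sub succ_exp4_sub subn1 /= -[(4 - 2)%N]/2%N.
by rewrite -[b.+2]addn1 -[(b.+1 ^ 2).+1]addn1 -[b.+1]addn1; lia.
Qed.

Lemma zeros_count_secant : zeros_count 2 = ((q ^ 4 - 1) * (q - 1) * q ^ 3 %/ 2)%N.
Proof. by rewrite -double_zeros_count_secant mulnK. Qed.

Lemma zeros_count_tangent : zeros_count 1 = (q ^ 7 - q ^ 5 + q ^ 4 - q ^ 3 + q - 1)%N.
Proof.
have := sum_bin_zeros_count (isT : 1 <= 3)%N.
rewrite !bin1 muln0 add0n muln1 double_zeros_count_secant zeros_count_circle nE.
move: (zeros_count _) => N; case: q q_gt2 => [//|b] _.
rewrite succ_exp7_sub succ_exp5_sub succ_exp4_sub subn1 /= -[(4 - 1)%N]/3%N.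
by rewrite -[b.+2]addn1 -[b.+1]addn1; lia.
Qed.

Lemma zeros_count_passant : zeros_count 0 = ((q ^ 4 - 1) * (q - 1) * q ^ 3 %/ 2)%N.
Proof.
suff <- : (zeros_count 0 * 2 = (q ^ 4 - 1) * (q - 1) * q ^ 3)%N by rewrite mulnK.
have := sum_bin_zeros_count (isT : 0 <= 3)%N; have := double_zeros_count_secant.
rewrite !bin0 !muln1 zeros_count_tangent zeros_count_circle.
move: (zeros_count 0) (zeros_count 2) => N M; case: q q_gt2 => [//|b] _.
rewrite succ_exp7_sub succ_exp5_sub succ_exp4_sub subn1 /= -[(4 - 0)%N]/4%N.
by rewrite -[b.+1]addn1; lia.
Qed.

Lemma wt_count_row_code (i : nat) : wt_count C i =
  (if i == 0%N then 1%N
   else if i == (q ^ 2 - q)%N then (q ^ 5 - q)%N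
   else if (i == (q ^ 2 - 1)%N) || (i == (q ^ 2 + 1)%N)
        then ((q ^ 4 - 1) * (q - 1) * q ^ 3 %/ 2)%N
   else if i == (q ^ 2)%N
        then (q ^ 7 - q ^ 5 + q ^ 4 - q ^ 3 + q - 1)%N
   else 0%N).
Proof.
have n_gt := length_gt.
have wt_zeros j k : (j + k = n)%N -> wt_count C j = zeros_count k.
  move=> jk; apply: eq_card => c; rewrite !inE; have := hweight_zeros c.
  by move=> h; congr andb; apply/eqP/eqP; lia.
have [->|i0] := eqVneq i 0%N.
  rewrite (wt_zeros 0%N n) //; apply/eqP/cards1P; exists 0; apply/setP=> c.
  rewrite !inE; have := hweight_zeros c; have [->|c0] := eqVneq c 0.
    by rewrite row_code0 zeros0 cardsT card_ord eqxx.
  rewrite -hweight_eq0 in c0; move=> h; apply/negP => /andP[_ /eqP]; lia.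
have sq : (q ^ 2 = q * q)%N by rewrite mulnn.
have [iE|i1] := eqVneq i (q ^ 2 - q)%N.
  by rewrite (wt_zeros i q.+1) ?zeros_count_circle //; nia.
have [iE|i2] /= := eqVneq i (q ^ 2 - 1)%N.
  by rewrite (wt_zeros i 2) ?zeros_count_secant //; nia.
have [iE|i3] /= := eqVneq i (q ^ 2 + 1)%N.
  by rewrite (wt_zeros i 0%N) ?zeros_count_passant //; lia.
have [iE|i4] := eqVneq i (q ^ 2)%N.
  by rewrite (wt_zeros i 1%N) ?zeros_count_tangent //; lia.
apply/eqP; rewrite cards_eq0; apply/eqP/setP=> c; rewrite !inE; apply/negP.
case/andP=> cC /eqP ci; have := hweight_zeros c; rewrite ci.
have c0 : c != 0 by rewrite -hweight_eq0 ci.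
by have := zeros_cases cC c0; rewrite !inE => /or4P[] /eqP->; nia.
Qed.

Lemma min_dist_row_code : min_dist C (q ^ 2 - q).
Proof.
have sq : (q ^ 2 = q * q)%N by rewrite mulnn.
have n_gt := length_gt; split.
  have /card_gt0P[c] : (0 < zeros_count q.+1)%N.
    by rewrite zeros_count_circle subn_gt0 -{1}(expn1 q) ltn_exp2l // ltnW.
  rewrite inE => /andP[cC /eqP zc]; exists c => //.
  have := hweight_zeros c; rewrite zc => h.
  by rewrite -hweight_eq0; apply/andP; split; apply/eqP; nia.
move=> c cC c0; have := hweight_zeros c.
by have := zeros_cases cC c0; rewrite !inE => /or4P[] /eqP->; nia.
Qed.

Lemma supports_min_weight :
  supports_of_weight C (q ^ 2 - q) = [set ~: b | b in circles].
Proof.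
have qq : (q <= q ^ 2)%N by rewrite -mulnn; nia.
have wz (c : 'rV[F]_n) : (hweight c == q ^ 2 - q)%N = (#|zeros c| == q.+1).
  by have := hweight_zeros c => h; apply/eqP/eqP; lia.
apply/setP=> b; apply/imsetP/imsetP => [[c + ->]|[_ /imsetP[c + ->] ->]].
  rewrite inE wz => cC; exists (zeros c); last by rewrite setCK.
  by apply/imsetP; exists c; rewrite ?inE.
by rewrite inE -wz => cC; exists c; rewrite ?inE // setCK.
Qed.

Lemma min_weight_design :
  is_design 3 n (q ^ 2 - q) ((q ^ 2 - q - 1) * (q - 2))
    (supports_of_weight C (q ^ 2 - q)).
Proof.
rewrite supports_min_weight; split=> [_ /imsetP[b bB ->]|S S3].
  by rewrite cardsCs setCK card_ord (card_circles bB) nE -mulnn; nia.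
have cardI : #|'I_n| = (q ^ 2 + 1)%N by rewrite card_ord.
rewrite -(card_blocks_avoiding_inversive (ltnW q_gt2) cardI card_circles
            circles_steiner S3).
(* Complementation matches the supports containing [S] with the circles disjoint from [S]. *)
rewrite -[RHS](card_imset _ (@setC_inj _)); apply: eq_card => b.
rewrite inE; apply/andP/imsetP=> [[/imsetP[b' b'B ->] Sb]|[b' + ->]].
  by exists b'; rewrite // inE b'B disjoints_subset.
by rewrite inE => /andP[b'B]; rewrite disjoints_subset imset_f.
Qed.

Lemma code_dim_row_code : code_dim C = 4.
Proof.
pose f : 'Hom('rV[F]_4, 'rV[F]_n) := linfun (mulmxr G).
have fE x : f x = x *m G by rewrite lfunE.
rewrite (@code_dim_vspace _ _ _ (limg f)); last first.
  move=> c; rewrite CE; apply/imsetP/memv_imgP=> [[x _ ->]|[x _ ->]]; exists x => //.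
  by rewrite memvf.
rewrite limg_dim_eq; first by rewrite dimvf /dim /= mul1n.
apply/eqP; rewrite -subv0; apply/subvP=> x; rewrite memv_cap memvf memv_ker fE memv0 /=.
by move=> /eqP xG; apply/eqP/(row_free_inj freeG); rewrite xG mul0mx.
Qed.

(** * The dual code and its design *)

Lemma in_dual_code d : (d \in dual_code C) = (d *m G^T == 0).
Proof.
rewrite inE; apply/forall_inP/eqP=> [dC|dG c].
  apply: trmx_inj; rewrite trmx_mul trmxK trmx0; apply/row_matrixP=> i.
  rewrite row_mul row0; apply/eqP/dC; rewrite CE.
  by apply/imsetP; exists (delta_mx 0 i); rewrite // rowE.
rewrite CE => /imsetP[x _ ->].
by rewrite -mulmxA -[G *m _]trmxK trmx_mul trmxK dG trmx0 mulmx0.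
Qed.

Lemma code_dim_dual : code_dim (dual_code C) = (n - 4)%N.
Proof.
pose f : 'Hom('rV[F]_n, 'rV[F]_4) := linfun (mulmxr G^T).
have fE x : f x = x *m G^T by rewrite lfunE.
rewrite (@code_dim_vspace _ _ _ (lker f)) => [|d]; last first.
  by rewrite in_dual_code memv_ker fE.
have := limg_ker_dim f fullv; rewrite capfv.
have -> : limg f = fullv.
  apply/eqP; rewrite eqEsubv subvf; apply/subvP=> y _.
  have /row_freeP[B GB] := freeG.
  apply/memv_imgP; exists (y *m B^T); rewrite ?memvf // fE.
  by rewrite -mulmxA -trmx_mul GB trmx1 mulmx1.
by rewrite !dimvf /dim /= !mul1n => dE; apply/esym/subn_eq/esym.
Qed.

(** When [c] vanishes on the rest of the support, the inner product of [c] and [d] reduces to the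
    single term at [x]. *)
Lemma support_dual_subset d c x : d \in dual_code C -> c \in C ->
  x \in Defs.support d -> Defs.support d :\ x \subset zeros c ->
  Defs.support d \subset zeros c.
Proof.
rewrite inE => /forall_inP dC cC xd sub.
rewrite -(setD1K xd) subUset sub sub1set andbT in_zeros.
have /eqP/matrixP/(_ 0 0) := dC c cC; rewrite !mxE (bigD1 x) //= big1 => [|i ix].
  rewrite addr0 mxE => /eqP; rewrite mulf_eq0 => /orP[] //.
  by move: xd; rewrite inE => /negPf->.
rewrite mxE; have [->|di] := eqVneq (d 0 i) 0; first by rewrite mulr0.
have /eqP-> : c 0 i == 0; last by rewrite mul0r.
by rewrite -in_zeros (subsetP sub) // !inE ix di.
Qed.

(** For a word of weight at most 3, vanishing on its support would follow from vanishing on the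
    support minus a point, but [card_vanishing] gives these two conditions different counts. *)
Lemma dual_weight_ge4 d : d \in dual_code C -> d != 0 -> (4 <= hweight d)%N.
Proof.
move=> dC d0; rewrite ltnNge; apply/negP=> w3.
have /card_gt0P[x xd] : (0 < #|Defs.support d|)%N by rewrite lt0n -hweight_eq0 in d0 *.
have cd := cardsD1 x (Defs.support d); rewrite xd add1n in cd.
have E : vanishing C (Defs.support d) = vanishing C (Defs.support d :\ x).
  apply/setP=> c; rewrite !inE; apply/andP/andP=> -[cC sub]; split=> //.
    by apply: subset_trans sub; apply: subsetDl.
  exact: support_dual_subset sub.
have := congr1 (fun V : {set _} => #|V|) E; rewrite !card_vanishing //; last first.
  by rewrite -ltnS -cd ltnW.
by move/(expnI (finNzRing_gt1 F)); rewrite /hweight in w3; lia.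
Qed.

(** Pigeonhole: at least [#|F| ^ 4] words are supported inside [S]. Their syndromes are all
    orthogonal to [x], where [x *m G] is the word defining [b], so they miss part of the space. Two
    words collide, and their difference is a dual word with support in [S], hence equal to [S] by
    the weight bound. *)
Lemma ex_dual_word (S b : {set 'I_n}) : #|S| = 4 -> b \in circles -> S \subset b ->
  exists2 d, d \in dual_code C & Defs.support d = S.
Proof.
move=> S4 /circlesP[c [cC c0] [-> _]] Sc.
have /imsetP[x _ cE] : c \in [set x *m G | x : 'rV[F]_4] by rewrite -CE.
pose W := vanishing [set: 'rV[F]_n] (~: S).
have subT (c1 c2 : 'rV[F]_n) : c1 \in setT -> c2 \in setT -> c1 - c2 \in setT.
  by rewrite !in_setT.
have x0 : x != 0 by apply: contraNneq c0 => x0; rewrite cE x0 mul0mx.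
have W_ge : (#|F| ^ 4 <= #|W|)%N.
  have := card_vanishing_sub subT (sub0set (~: S)).
  rewrite vanishing0 cardsT card_mx mul1n cards0 subn0.
  have nS : n = (#|~: S| + 4)%N by have := cardsC S; rewrite card_ord S4; lia.
  by rewrite [X in (_ ^ X <= _)%N]nS expnD leq_pmul2l // expn_gt0 ltnW // finNzRing_gt1.
have img_small : (#|[set d *m G^T | d in W]| < #|F| ^ 4)%N.
  have -> : (#|F| ^ 4 = #|[set: 'rV[F]_4]|)%N by rewrite cardsT card_mx mul1n.
  (* If every syndrome occurred, some [delta_mx 0 j] with [x 0 j != 0] would be one, against
     orthogonality to [x]. *)
  apply: proper_card; rewrite properT; apply/negP => /eqP imgT.
  have [j xj] : exists j, x 0 j != 0.
    apply/existsP; apply: contraNT x0 => /existsPn xj; apply/eqP/rowP=> j.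
    by rewrite mxE; apply/eqP; have := xj j; rewrite negbK.
  have := in_setT (delta_mx 0 j : 'rV[F]_4); rewrite -imgT => /imsetP[d dW dj].
  have : d *m c^T = 0.
    apply/matrixP=> i k; rewrite !mxE big1 // => l _; rewrite mxE !ord1.
    have [lS|lS] := boolP (l \in S).
      by have := subsetP Sc l lS; rewrite in_zeros => /eqP->; rewrite mulr0.
    move: dW; rewrite inE => /andP[_ /subsetP/(_ l)]; rewrite inE lS in_zeros.
    by move=> /(_ isT)/eqP->; rewrite mul0r.
  rewrite cE trmx_mul mulmxA -dj -rowE => /matrixP/(_ 0 0); rewrite !mxE => xj0.
  by rewrite xj0 eqxx in xj.
have /dinjectivePn : ~~ dinjectiveb (fun d : 'rV[F]_n => d *m G^T) (mem W).
  apply/negP=> /dinjectiveP/card_in_imset E.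
  by move: img_small; rewrite E ltnNge W_ge.
case=> d dW [e]; rewrite !inE => /andP[de eW] Gde.
have wC : d - e \in dual_code C by rewrite in_dual_code mulmxBl Gde subrr.
have wS : Defs.support (d - e) \subset S.
  have {}eW : e \in W by rewrite inE in_setT.
  by have := vanishingB subT dW eW; rewrite inE setCS => /andP[].
exists (d - e); first exact: wC.
apply/eqP; rewrite eqEcard wS S4.
by apply: dual_weight_ge4; rewrite // subr_eq0 eq_sym.
Qed.

Lemma dual_supportsP (S : {set 'I_n}) :
  reflect (#|S| = 4 /\ exists2 b, b \in circles & S \subset b)
  (S \in supports_of_weight (dual_code C) 4).
Proof.
apply: (iffP imsetP) => [[d + ->]|[S4 [b bC Sb]]].
  rewrite inE => /andP[dC /eqP d4]; split=> //.
  (* Three points of the support determine a circle; the parity check [d] then forces the fourth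
     onto it. *)
  have /card_gt0P[x xd] : (0 < #|Defs.support d|)%N by rewrite [#|_|]d4.
  have T3 : #|Defs.support d :\ x| = 3.
    by apply: succn_inj; rewrite -d4 [in RHS]/hweight (cardsD1 x (Defs.support d)) xd.
  have [c cV c0] := ex_vanishing T3.
  exists (zeros c); first exact: vanishing_circle T3 cV c0.
  by move: cV; rewrite inE => /andP[cC]; apply: support_dual_subset.
have [d dC dS] := ex_dual_word S4 bC Sb.
by exists d => //; rewrite inE dC /hweight dS S4.
Qed.

(** The 4-sets through [T] arise by adding one of the [q.+1 - 3] remaining points of the unique
    circle through [T]. *)
Lemma dual_min_weight_design :
  is_design 3 n 4 (q - 2) (supports_of_weight (dual_code C) 4).
Proof.
split=> [S /dual_supportsP[]//|T T3].
have /eqP/cards1P[b bE] := circles_steiner T3.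
have : b \in blocks_through circles T by rewrite bE inE.
rewrite inE => /andP[bC Tb].
have -> : (q - 2 = #|b :\: T|)%N by rewrite cardsDS // T3 (card_circles bC); lia.
rewrite -[RHS](card_in_imset (f := fun x => x |: T)); last first.
  move=> x y; rewrite !inE => /andP[xT _] /andP[yT _] /setP/(_ x).
  by rewrite !inE eqxx (negPf xT) !orbF => /esym/eqP.
apply: eq_card => S; rewrite inE; apply/andP/imsetP.
  case=> /dual_supportsP[S4 [b' b'C Sb'] TS].
  have : b' \in blocks_through circles T by rewrite inE b'C (subset_trans TS).
  rewrite bE inE => /eqP b'E; subst b'.
  have /eqP/cards1P[x xE] : #|S :\: T| = 1%N by rewrite cardsDS // S4 T3.
  have : x \in S :\: T by rewrite xE inE.
  rewrite inE => /andP[xT xS]; exists x; first by rewrite inE xT (subsetP Sb').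
  by rewrite -(setID S T) xE (setIidPr TS) setUC.
case=> x; rewrite inE => /andP[xT xb] ->; split; last exact: subsetUr.
apply/dual_supportsP; rewrite cardsU1 xT T3; split=> //.
by exists b; rewrite // subUset sub1set xb.
Qed.

Lemma min_dist_dual : min_dist (dual_code C) 4.
Proof.
split=> [|d]; last exact: dual_weight_ge4.
have [|T _ T3] := @subset_of_card _ 3 (set0 : {set 'I_n}).
  by rewrite cards0 card_ord; have := length_gt; lia.
have [_ /(_ T T3) cT] := dual_min_weight_design.
have /card_gt0P[S] : (0 < #|[set b in supports_of_weight (dual_code C) 4 | T \subset b]|)%N.
  by rewrite cT; lia.
rewrite inE => /andP[/imsetP[d + _] _]; rewrite inE => /andP[dC d4].
by exists d; rewrite // d4 -hweight_eq0 (eqP d4).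
Qed.

End FourDimensionalCode.

(** * Constacyclic codes *)

Lemma inverse_dft (K : fieldType) (n : nat) (delta zeta : K) (p : {poly K}) i :
  n.-primitive_root zeta -> delta != 0 -> (size p <= n)%N -> (i < n)%N ->
  \sum_(j < n) p.[delta * zeta ^+ j] / (delta * zeta ^+ j) ^+ i = n%:R * p`_i.
Proof.
move=> zP d0 size_p i_lt.
have n_gt0 := prim_order_gt0 zP.
have z0 : zeta != 0.
  apply: contra_eqN (prim_expr_order zP) => /eqP->.
  by rewrite expr0n gtn_eqF // eq_sym oner_eq0.
under eq_bigr => j _ do rewrite (horner_coef_wide _ size_p) mulr_suml.
rewrite exchange_big /= (bigD1 (Ordinal i_lt)) //= [X in _ + X]big1 ?addr0 => [|k ki].
  rewrite (eq_bigr (fun=> p`_i)); first by rewrite big_const_ord iter_addr_0 mulr_natl.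
  by move=> j _; rewrite mulfK // expf_neq0 // mulf_neq0 // expf_neq0.
pose x := zeta ^+ k / zeta ^+ i.
rewrite (eq_bigr (fun j : 'I_n => p`_k * (delta ^+ k / delta ^+ i) * x ^+ j)); last first.
  move=> j _; rewrite /x !exprMn exprVn -!exprM ![(j * _)%N]mulnC.
  by field; rewrite !expf_neq0.
have x1 : x != 1.
  rewrite -(inj_eq (mulIf (expf_neq0 i z0))) mulfVK ?expf_neq0 // mul1r.
  by rewrite (eq_prim_root_expr zP) !modn_small.
have xn : x ^+ n = 1.
  by rewrite /x expr_div_n -!exprM ![(_ * n)%N]mulnC !exprM (prim_expr_order zP)
             !expr1n divr1.
have : (x - 1) * \sum_(j < n) x ^+ j = 0 by rewrite -subrX1 xn subrr.
by move/eqP; rewrite mulf_eq0 subr_eq0 (negPf x1) /= -mulr_sumr => /eqP->; rewrite mulr0.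
Qed.

Lemma cw_polyE (F : fieldType) (n : nat) (c : 'rV[F]_n) : cw_poly c = rVpoly c.
Proof.
apply/polyP=> i; rewrite coef_sum coef_rVpoly; case: insubP => [k _ ki|i_ge] /=.
  rewrite (bigD1 k) //= coefZ coefXn -ki eqxx mulr1 big1 ?addr0 // => l lk.
  by rewrite coefZ coefXn (inj_eq val_inj) eq_sym (negPf lk) mulr0.
rewrite big1 // => l _; rewrite coefZ coefXn; case: eqP => [il|]; last by rewrite mulr0.
by rewrite il ltn_ord in i_ge.
Qed.

Section Constacyclic.

Variables (F K : finFieldType) (iota : {rmorphism F -> K}) (n : nat) (lam : F).
Variables (delta zeta : K) (rs : seq K) (h : {poly F}).
Hypotheses (zetaP : n.-primitive_root zeta) (delta0 : delta != 0)
  (deltan : delta ^+ n = iota lam) (uniq_rs : uniq rs)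
  (rs_root : forall x, x \in rs -> x ^+ n = iota lam)
  (hE : map_poly iota h = \prod_(x <- rs) ('X - x%:P)).

Let g := gen_of_check n lam h.
Let n_gt0 : (0 < n)%N := prim_order_gt0 zetaP.

Lemma map_XnsubC : map_poly iota ('X^n - lam%:P) = 'X^n - (iota lam)%:P.
Proof. by rewrite rmorphB /= map_polyXn map_polyC. Qed.

Lemma gen_mul_check : g * h = 'X^n - lam%:P.
Proof.
apply: divpK; rewrite -(dvdp_map iota) hE map_XnsubC.
apply: uniq_roots_dvdp; last by rewrite uniq_rootsE.
apply/allP=> x /rs_root xn.
by rewrite rootE !hornerE xn subrr.
Qed.

Lemma gen_neq0 : g != 0.
Proof.
apply: contra_eqN gen_mul_check => /eqP->; rewrite mul0r eq_sym.
by rewrite -size_poly_eq0 size_XnsubC.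
Qed.

Lemma size_gen : (size g + size rs)%N = n.+1.
Proof.
have h0 : h != 0.
  apply: contra_eqN gen_mul_check => /eqP->; rewrite mulr0 eq_sym.
  by rewrite -size_poly_eq0 size_XnsubC.
have sh : size h = (size rs).+1.
  by rewrite -(size_map_poly iota) hE size_prod_XsubC.
have := congr1 (fun p : {poly F} => size p) gen_mul_check.
by rewrite size_XnsubC // size_mul ?gen_neq0 // sh addnS /=.
Qed.

(** The word polynomial is divisible by [g], so among the roots of [x ^ n - lam] it can be nonzero
    only at those of [h]; only these terms survive in the inverse transform. *)
Lemma constacyclic_spectrum c : c \in constacyclic_code n lam h ->
  exists e : K -> K, forall i, n%:R * iota (c 0 i) = \sum_(x <- rs) e x / x ^+ i.
Proof.
rewrite inE cw_polyE => gc.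
pose p := map_poly iota (rVpoly c); exists (horner p) => i.
have size_p : (size p <= n)%N by rewrite size_map_poly size_poly.
have pi : p`_i = iota (c 0 i) by rewrite coef_map coef_rVpoly_ord.
rewrite -pi -(inverse_dft zetaP delta0 size_p (ltn_ord i)) [RHS]big_uniq //=.
have inj : injective (fun j : 'I_n => delta * zeta ^+ j).
  move=> j k /(mulfI delta0)/eqP; rewrite (eq_prim_root_expr zetaP) !modn_small //.
  by move/eqP/val_inj.
pose R := [set delta * zeta ^+ (j : 'I_n) | j : 'I_n].
transitivity (\sum_(x in R) p.[x] / x ^+ i).
  by rewrite big_imset //= => j k _ _; apply: inj.
rewrite big_mkcond [RHS]big_mkcond; apply: eq_bigr => x _.
have rootsE : (x \in R) = (x ^+ n == iota lam).
  apply/imsetP/eqP=> [[j _ ->]|xn].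
    by rewrite exprMn -exprM mulnC exprM (prim_expr_order zetaP) expr1n mulr1.
  have : (x / delta) ^+ n = 1.
    by rewrite expr_div_n xn deltan divff // -deltan expf_neq0.
  by case/(prim_rootP zetaP)=> j xE; exists j; rewrite // -xE mulrC divfK.
rewrite rootsE; have [/rs_root->|x_rs] := boolP (x \in rs); first by rewrite eqxx.
case: eqP => // xn; rewrite (_ : p.[x] = 0) ?mul0r //; apply/eqP.
have gx : root (map_poly iota g) x.
  have := congr1 (fun f => (map_poly iota f).[x]) gen_mul_check.
  rewrite /= rmorphM /= map_XnsubC hornerM !hornerE xn subrr => /eqP.
  by rewrite mulf_eq0 -!rootE hE root_prod_XsubC (negPf x_rs) orbF.
rewrite -rootE; move: gx; rewrite !root_factor_theorem => /dvdp_trans; apply.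
by rewrite dvdp_map.
Qed.

(** The rows are the shifts of [g] by ['X^i] for [i < size rs], the degree of [h]. *)
Lemma constacyclic_generator_matrix : exists2 G : 'M[F]_(size rs, n), row_free G &
  constacyclic_code n lam h = [set x *m G | x : 'rV[F]_(size rs)].
Proof.
pose G := \matrix_(i < size rs) (poly_rV (g * 'X^i) : 'rV[F]_n).
have size_gM (x : 'rV[F]_(size rs)) : (size (g * rVpoly x)%R <= n)%N.
  apply: leq_trans (size_polyMleq _ _) _; rewrite -ltnS prednK.
    by rewrite -size_gen leq_add2l size_poly.
  by rewrite addn_gt0 lt0n size_poly_eq0 gen_neq0.
have GE x : rVpoly (x *m G) = g * rVpoly x.
  rewrite -[RHS](poly_rV_K (size_gM x)); congr rVpoly.
  rewrite mulmx_sum_row -[in RHS]cw_polyE /cw_poly mulr_sumr linear_sum.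
  by apply: eq_bigr => i _; rewrite rowK -scalerAr linearZ.
exists G.
  apply: inj_row_free => x xG; have := GE x; rewrite xG linear0 => /esym/eqP.
  by rewrite mulf_eq0 (negPf gen_neq0) => /eqP/(canRL rVpolyK)->; rewrite linear0.
apply/setP=> c; rewrite inE cw_polyE -/g; apply/idP/imsetP=> [/dvdpP[f fE]|[x _ ->]].
  exists (poly_rV f) => //; apply: (can_inj rVpolyK); rewrite GE poly_rV_K.
    by rewrite fE mulrC.
  have [->|f0] := eqVneq f 0; first by rewrite size_poly0.
  have := size_poly _ _ : (size (rVpoly c) <= n)%N.
  by rewrite fE size_mul ?gen_neq0 // -ltnS prednK ?addn_gt0 ?lt0n ?size_poly_eq0 ?f0 //
             -size_gen addnC leq_add2l.
by rewrite GE dvdp_mulr.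
Qed.

End Constacyclic.

(** Write [q + 1 = s * r]; the 2-adic condition makes [s] odd. As [q ^ 2 + 1] is 2 modulo [s], it is
    coprime to [s]. *)
Lemma gcdn_succ_mul (q r : nat) : (0 < q)%N -> (r %| q + 1)%N ->
  logn 2 r = logn 2 (q + 1) -> gcdn (q + 1) (r * (q ^ 2 + 1)) = r.
Proof.
move=> q_gt0 /dvdnP[s qE] l2.
have s_gt0 : (0 < s)%N by case: s qE => //; rewrite mul0n addn1.
have r_gt0 : (0 < r)%N by case: r {l2} qE => //; rewrite muln0 addn1.
have l2s : logn 2 s = 0%N by move: l2; rewrite qE lognM //; lia.
have odd_s : ~~ (2 %| s)%N.
  by move/eqP: l2s; apply: contraL => s2; rewrite -lt0n logn_gt0 mem_primes s_gt0.
rewrite qE mulnC -muln_gcdr.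
suff -> : gcdn s (q ^ 2 + 1) = 1%N by rewrite muln1.
have E : (q ^ 2 + 1 = (q - 1) * r * s + 2)%N.
  by rewrite -mulnA [(r * s)%N]mulnC -qE -mulnn; case: (q) q_gt0 => // k _; nia.
rewrite E gcdnMDl; apply/eqP.
by rewrite -[_ == _]/(coprime s 2) coprime_sym prime_coprime.
Qed.

(** Modulo [q ^ 2 + 1] the exponents are 1, -1, [q] and [-q]. *)
Lemma exponents_mod_uniq (q : nat) : (2 < q)%N ->
  uniq [seq k %% (q ^ 2 + 1) | k <- [:: 1; q ^ 2; q ^ 2 + q + 1; q ^ 4 + q ^ 3 + q ^ 2]]%N.
Proof.
move=> q_gt2.
have lt_q : (2 * q < q ^ 2 + 1)%N by rewrite -mulnn; nia.
have e3 : (q ^ 2 + q + 1 = 1 * (q ^ 2 + 1) + q)%N by lia.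
have e4 : (q ^ 4 + q ^ 3 + q ^ 2 = (q ^ 2 + q - 1) * (q ^ 2 + 1) + (q ^ 2 + 1 - q))%N.
  case: q q_gt2 {lt_q e3} => // b _; rewrite (@subn_eq _ _ (b.+1 ^ 2 + b)); last by lia.
  rewrite (@subn_eq _ _ (b.+1 * b + 1)%N); last by rewrite -[b.+1]addn1; ring.
  by rewrite -[b.+1]addn1; ring.
rewrite /= e4 e3 !modnMDl !modn_small; try lia.
by rewrite !inE !negb_or; apply/and4P; split; try apply/and3P; try split;
  try apply/andP; try split => //; rewrite -?mulnn; nia.
Qed.

(** The hypothesis on [d] turns the last inverse power into [d ^+ q]. Once [d ^+ q] is factored out,
    the other three terms become powers of the inverse of [d ^+ (q + 1)], with exponents 1, [q] and
    [q + 1]. *)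
Lemma inverse_powers_circle_form (K : fieldType) (q : nat) (d e1 e2 e3 e4 : K) :
  d != 0 -> d ^+ (q ^ 4 + q ^ 3 + q ^ 2 + q) = 1 ->
  e1 / d + (e2 / d ^+ (q ^ 2) + (e3 / d ^+ (q ^ 2 + q + 1)
    + e4 / d ^+ (q ^ 4 + q ^ 3 + q ^ 2))) =
  d ^+ q * circle_form q e4 e1 e2 e3 (d ^+ (q + 1))^-1.
Proof.
move=> d0 d1.
have e4E : (d ^+ (q ^ 4 + q ^ 3 + q ^ 2))^-1 = d ^+ q.
  apply: (mulfI (expf_neq0 (q ^ 4 + q ^ 3 + q ^ 2) d0)).
  by rewrite mulfV ?expf_neq0 // -exprD d1.
rewrite e4E /circle_form exprVn.
rewrite [d ^+ (q ^ 2 + q + 1)]exprD [d ^+ (q ^ 2 + q)]exprD [d ^+ (q + 1)]exprD !expr1.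
rewrite exprMn -exprM mulnn.
by field; rewrite !expf_neq0.
Qed.

Lemma uniq_map_refine (T : Type) (U V : eqType) (f : T -> U) (g : T -> V) (s : seq T) :
  (forall x y, g x = g y -> f x = f y) ->
  uniq [seq f x | x <- s] -> uniq [seq g x | x <- s].
Proof.
move=> gf; elim: s => //= x s IHs /andP[xs /IHs->]; rewrite andbT.
apply: contra xs; elim: s {IHs} => //= y s IHs; rewrite !inE.
by case/orP=> [/eqP/gf->|/IHs->]; rewrite ?eqxx ?orbT.
Qed.

(** All four exponents are 1 modulo [q + 1], hence modulo [r], so the corresponding powers of
    [delta] are all roots of [x ^ n - lam]. *)
Lemma exponents_mod_succ (q k : nat) : (0 < q)%N ->
  k \in [:: 1; q ^ 2; q ^ 2 + q + 1; q ^ 4 + q ^ 3 + q ^ 2]%N ->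
  exists l, k = (l * (q + 1) + 1)%N.
Proof.
move=> q_gt0.
have sq : (q ^ 2 = (q - 1) * (q + 1) + 1)%N.
  by rewrite -mulnn; case: q q_gt0 => // b _; nia.
rewrite !inE => /or4P[] /eqP->.
- by exists 0%N.
- by exists (q - 1)%N.
- by exists q; rewrite -mulnn; lia.
- by exists (q ^ 3 + (q - 1))%N; rewrite {1}sq (expnSr q 3); lia.
Qed.

Theorem theorem3p2 (p m q n r : nat) (F K : finFieldType)
  (iota : {rmorphism F -> K}) (lam : F) (delta : K) (h : {poly F}) :
  prime p -> (0 < m)%N -> q = (p ^ m)%N -> (2 < q)%N -> n = (q ^ 2 + 1)%N ->
  #|F| = (q ^ 2)%N -> #|K| = (q ^ 4)%N ->
  r.-primitive_root lam -> (r %| q + 1)%N -> logn 2 r = logn 2 (q + 1) ->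
  (r * n)%N.-primitive_root delta -> delta ^+ n = iota lam ->
  map_poly iota h =
    (('X - (delta)%:P) * ('X - (delta ^+ (q ^ 2)%N)%:P)) *
    (('X - (delta ^+ (q ^ 2 + q + 1)%N)%:P) *
     ('X - (delta ^+ (q ^ 4 + q ^ 3 + q ^ 2)%N)%:P)) ->
  let C := constacyclic_code n lam h in
  [/\ code_params C 4 (q ^ 2 - q)%N,
      (forall i : nat, wt_count C i =
         if i == 0%N then 1%N
         else if i == (q ^ 2 - q)%N then (q ^ 5 - q)%N
         else if (i == (q ^ 2 - 1)%N) || (i == (q ^ 2 + 1)%N)
              then ((q ^ 4 - 1) * (q - 1) * q ^ 3 %/ 2)%N
         else if i == (q ^ 2)%N
              then (q ^ 7 - q ^ 5 + q ^ 4 - q ^ 3 + q - 1)%N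
         else 0%N),
      is_design 3 n (q ^ 2 - q)%N ((q ^ 2 - q - 1) * (q - 2))%N
        (supports_of_weight C (q ^ 2 - q)%N),
      code_params (dual_code C) (q ^ 2 - 3)%N 4 &
      is_design 3 n 4 (q - 2)%N (supports_of_weight (dual_code C) 4)].
Proof.
move=> p_prime m_gt0 qE q_gt2 nE cardF cardK lamP r_dvd r_val deltaP deltan hE C.
have q_gt1 : (1 < q)%N by exact: ltnW.
have q_gt0 : (0 < q)%N by exact: ltnW.
have pK : p \in [pchar K].
  by apply: (@card_finPcharP _ p (m * 4)); rewrite // cardK qE expnM.
have frob (x y : K) : (x - y) ^+ q = x ^+ q - y ^+ q.
  have pq : [pchar K].-nat q.
    by rewrite (eq_pnat _ (pcharf_eq pK)) qE pnatX pnat_id.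
  by rewrite exprDn_pchar // exprNn_pchar.
(* [q] is 0 in characteristic [p], so the factor [n] of the inverse transform disappears. *)
have n1 : n%:R = 1 :> K.
  rewrite nE natrD -mulnn natrM qE -(prednK m_gt0) expnS natrM (pcharf0 pK).
  by rewrite !mul0r add0r.
have r_gt0 := prim_order_gt0 lamP.
have delta0 : delta != 0.
  apply: contra_eqN (prim_expr_order deltaP) => /eqP->.
  by rewrite expr0n gtn_eqF ?(prim_order_gt0 deltaP) // eq_sym oner_eq0.
have zetaP : n.-primitive_root (delta ^+ r).
  by have := exp_prim_root deltaP r; rewrite gcdnMr mulKn.
have zP : n.-primitive_root (delta ^+ (q + 1)).
  have := exp_prim_root deltaP (q + 1).
  by rewrite {2}nE gcdn_succ_mul // mulKn.
pose es := [:: 1; q ^ 2; q ^ 2 + q + 1; q ^ 4 + q ^ 3 + q ^ 2]%N.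
pose rs := [seq delta ^+ k | k <- es].
have uniq_rs : uniq rs.
  have := exponents_mod_uniq q_gt2; rewrite -nE; apply: uniq_map_refine => k l /eqP.
  rewrite (eq_prim_root_expr deltaP) => /eqP kl.
  by rewrite -(@modn_dvdm (r * n) k n) ?kl ?modn_dvdm // dvdn_mull.
have lam_exp k : (lam ^+ (k * (q + 1) + 1) = lam)%R.
  have /dvdnP[s ->] := r_dvd.
  by rewrite exprD mulnA mulnC exprM (prim_expr_order lamP) expr1n mul1r expr1.
have rs_root x : x \in rs -> x ^+ n = iota lam.
  case/mapP=> k kes ->; rewrite exprAC deltan -rmorphXn; congr (iota _).
  by have [l ->] := exponents_mod_succ q_gt0 kes; apply: lam_exp.
have hE' : map_poly iota h = \prod_(x <- rs) ('X - x%:P).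
  by rewrite hE !big_cons big_nil mulr1 expr1 !mulrA.
have [G freeG CE] := constacyclic_generator_matrix zetaP uniq_rs rs_root hE'.
rewrite -/C in CE.
pose u (i : 'I_n) := (delta ^+ (q + 1) ^+ i)^-1.
have u_inj : injective u.
  move=> i j /invr_inj/eqP; rewrite (eq_prim_root_expr zP) !modn_small //.
  by move/eqP/val_inj.
have u_unity i : u i ^+ n = 1.
  by rewrite /u exprVn -(exprM _ i) mulnC exprM (prim_expr_order zP) expr1n invr1.
have word_form c : c \in C -> exists a0 a1 a2 a3, forall i,
    iota (c 0 i) = (delta ^+ i) ^+ q * circle_form q a0 a1 a2 a3 (u i).
  move=> cC.
  have [e eE] := constacyclic_spectrum zetaP delta0 deltan uniq_rs rs_root hE' cC.
  exists (e (delta ^+ (q ^ 4 + q ^ 3 + q ^ 2))), (e (delta ^+ 1)).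
  exists (e (delta ^+ (q ^ 2))), (e (delta ^+ (q ^ 2 + q + 1))) => i.
  have := eE i; rewrite n1 mul1r => ->; rewrite !big_cons big_nil addr0.
  rewrite /u ![_ ^+ _ ^+ i]exprAC !expr1.
  apply: inverse_powers_circle_form; first exact: expf_neq0.
  (* The exponent sum is [q * (q + 1) * n], a multiple of the order [r * n] of [delta]. *)
  have /dvdnP[s sE] := r_dvd.
  have -> : (q ^ 4 + q ^ 3 + q ^ 2 + q = r * n * (s * q))%N.
    by transitivity ((q + 1) * n * q)%N; [rewrite nE; ring | rewrite sE; ring].
  by rewrite exprAC exprM (prim_expr_order deltaP) !expr1n.
have pencil (S : {set 'I_n}) : #|S| = 3 -> exists2 psi : 'I_n -> K,
    #|[set i | psi i == 0]| = q.+1 &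
    forall c, c \in vanishing C S -> exists b, forall i, iota (c 0 i) = b * psi i.
  move=> S3.
  have w0 (i : 'I_n) : (delta ^+ i) ^+ q != 0 by rewrite !expf_neq0.
  have [psi psi0 psiE] := circle_pencil nE q_gt1 cardK frob u_inj u_unity S3.
  exists (fun i : 'I_n => (delta ^+ i) ^+ q * psi i).
    by rewrite -psi0; apply: eq_card => i; rewrite !inE mulf_eq0 (negPf (w0 i)).
  move=> c; rewrite inE => /andP[/word_form[a0 [a1 [a2 [a3 cE]]]] /subsetP Sc].
  have [|b bE] := psiE a0 a1 a2 a3.
    move=> i /Sc; rewrite in_zeros => /eqP ci; apply: (mulfI (w0 i)).
    by rewrite -cE ci rmorph0 mulr0.
  by exists b => i; rewrite cE bE mulrCA.
have iota_eq0 (x : F) : (iota x == 0) = (x == 0) by rewrite fmorph_eq0.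
have three_zeros c : c \in C -> c != 0 -> (3 <= #|zeros c|)%N -> #|zeros c| = q.+1.
  move=> cC c0 zc.
  (* For any three zeros [S] of [c], the word is a nonzero multiple of the function [psi] attached
     to [S], so both have the same zeros. *)
  have /card_gt0P[S] : (0 < #|[set S : {set 'I_n} | S \subset zeros c & #|S| == 3]|)%N.
    by rewrite cards_draws bin_gt0.
  rewrite inE => /andP[Sc /eqP S3]; have [psi <- psiE] := pencil S S3.
  have [|b bE] := psiE c; first by rewrite inE cC.
  apply: eq_card => i; rewrite in_zeros inE -iota_eq0 bE mulf_eq0.
  rewrite (negPf (_ : b != 0)) //; apply: contraNneq c0 => b0; apply/eqP/rowP=> j.
  by apply/eqP; rewrite mxE -iota_eq0 bE b0 mul0r.
have proportional (S : {set 'I_n}) c d i : #|S| = 3 ->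
    c \in vanishing C S -> d \in vanishing C S -> c 0 i != 0 -> d 0 i = 0 -> d = 0.
  move=> S3 cV dV ci di; have [psi _ psiE] := pencil S S3.
  have [b bE] := psiE c cV; have [b' b'E] := psiE d dV.
  have psi_i : psi i != 0.
    by apply: contraNneq ci => psi_i; rewrite -iota_eq0 bE psi_i mulr0.
  have /eqP : b' * psi i = 0 by rewrite -b'E di rmorph0.
  rewrite mulf_eq0 (negPf psi_i) orbF => /eqP b'0; apply/rowP=> j.
  by apply/eqP; rewrite mxE -iota_eq0 b'E b'0 mul0r.
split.
- split; first exact: code_dim_row_code freeG CE.
  exact: min_dist_row_code CE three_zeros proportional.
- exact: wt_count_row_code CE three_zeros proportional.
- exact: min_weight_design CE three_zeros proportional.
- split; last exact: min_dist_dual CE three_zeros proportional.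
  by rewrite (code_dim_dual freeG CE) nE addn1 subSS.
- exact: dual_min_weight_design CE three_zeros proportional.
Qed.
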